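(* For each $(d,n)\in\{(10,256),(11,276),(12,296),(13,336),(15,456),(16,576),(17,816)\}$ there exists a set $\mathcal{X}\subset\mathbb{R}^d$ of unit vectors with $|\mathcal{X}|=n$ spanning biangular lines with $A(\mathcal{X})\subseteq\{\pm1/5,\pm3/5\}$.
   Context: For a finite set $\mathcal{X}\subset\mathbb{R}^d$ of unit vectors put $A(\mathcal{X}):=\{\langle x,x'\rangle\colon x\neq x';\ x,x'\in\mathcal{X}\}$. The set $\mathcal{X}$ spans a system of biangular lines (the lines through the origin in the directions $x\in\mathcal{X}$) if $-1\notin A(\mathcal{X})$ and $|\{\gamma^2\colon\gamma\in A(\mathcal{X})\}|\leq 2$. *)

(* Defs.v *)
From HB Require Import structures.
From mathcomp Require Import all_boot all_order all_algebra.
From mathcomp Require Import finmap reals.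

Set Implicit Arguments.
Unset Strict Implicit.
Unset Printing Implicit Defensive.

Import Order.TTheory GRing.Theory Num.Theory.
Local Open Scope fset_scope.
Local Open Scope ring_scope.

Section BiangularLines.
Context {R : realType} {d : nat}.
Implicit Types (u v : 'rV[R]_d) (X : {fset 'rV[R]_d}).

Definition inner u v : R := \sum_(i < d) u 0 i * v 0 i.

(* The Euclidean norm; the library's norm on row vectors is the sup norm. *)
Definition enorm u : R := Num.sqrt (inner u u).

Definition unit_vectors X : Prop := {in X, forall u, enorm u = 1}.

Definition angle_set X : {fset R} :=
  [fset inner u v | u in X, v in X & u != v].

(* For unit vectors, -1 \notin angle_set X says that X contains no two antipodal
   vectors, so that distinct vectors of X span distinct lines. *)
Definition spans_biangular X : Prop :=
  -1 \notin angle_set X /\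
  (#|` [fset g ^+ 2 | g in angle_set X] | <= 2)%N.

End BiangularLines.

(* Main.v *)
(** The [2 ^ 8] sign vectors of even weight in [R^10], taken up to sign and
    rescaled by [1 / sqrt 10], have mutual inner products [1 - |S| / 5] with
    [|S|] in [{2, 4, 6, 8}].  If the unit vectors [e_j] of [R^k] have mutual
    inner products [+-1/3], the vectors [(+-2 b_i, sqrt 6 e_j) / sqrt 10], for
    [b_i] the standard basis of [R^10], can be added: this gives
    [256 + 20 m] vectors in [R^(10 + k)] from [m] equiangular lines of [R^k].
    The numbers of equiangular lines needed are [0, 1, 2, 4, 10, 16, 28] for
    [k = 0, 1, 2, 3, 5, 6, 7]; for [k = 7] they come from the signed lines of
    the Fano plane. *)
Require Import Defs.
From mathcomp Require Import all_boot all_order all_algebra.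
From mathcomp Require Import finmap reals.
From mathcomp Require Import ring lra.

Set Implicit Arguments.
Unset Strict Implicit.
Unset Printing Implicit Defensive.

Import Order.TTheory GRing.Theory Num.Theory.
Local Open Scope fset_scope.
Local Open Scope ring_scope.

(** * Inner products and families of unit vectors *)

Section InnerProduct.
Context {R : realType}.

Lemma innerC d (u v : 'rV[R]_d) : inner u v = inner v u.
Proof. by apply: eq_bigr => i _; rewrite mulrC. Qed.

Lemma innerZ d (a b : R) (u v : 'rV[R]_d) :
  inner (a *: u) (b *: v) = a * b * inner u v.
Proof. by rewrite /inner mulr_sumr; apply: eq_bigr => i _; rewrite !mxE mulrACA. Qed.

Lemma inner0r d (u : 'rV[R]_d) : inner u 0 = 0.
Proof. by apply: big1 => i _; rewrite mxE mulr0. Qed.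

Lemma inner_delta d (u : 'rV[R]_d) i : inner u (delta_mx 0 i) = u 0 i.
Proof.
rewrite /inner (bigD1 i) //= mxE !eqxx mulr1 big1 ?addr0 // => j /negPf ji.
by rewrite mxE ji andbF mulr0.
Qed.

Lemma inner_row_mx d k (u u' : 'rV[R]_d) (v v' : 'rV[R]_k) :
  inner (row_mx u v) (row_mx u' v') = inner u u' + inner v v'.
Proof.
rewrite /inner big_split_ord /=.
by congr (_ + _); apply: eq_bigr => i _; rewrite ?row_mxEl ?row_mxEr.
Qed.

Definition angles : seq R := [:: 1 / 5; - (1 / 5); 3 / 5; - (3 / 5)].

(** As 1 is not in [angles], such a family is injective, so no vectors are lost in passing to the
    set. Also -1 is not in [angles], and the only squares are 1/25 and 9/25. *)
Lemma biangular_of_family d (I : finType) (v : I -> 'rV[R]_d) :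
    (forall i, inner (v i) (v i) = 1) ->
    (forall i j, i != j -> inner (v i) (v j) \in angles) ->
  exists X : {fset 'rV[R]_d},
    [/\ unit_vectors X, #|` X| = #|I|, spans_biangular X &
        {subset angle_set X <= angles}].
Proof.
move=> v1 vij; pose X := [fset v i | i in I].
have v_inj : injective v.
  move=> i j eq_v; apply/eqP/negPn/negP => /vij; rewrite eq_v v1 !inE.
  by case/or4P => /eqP; lra.
have XA : {subset angle_set X <= angles}.
  move=> _ /imfset2P[_ /imfsetP[i _ ->] [w /[!inE] /andP[/imfsetP[j _ ->] ne] ->]].
  by have := vij i j; rewrite !inE; apply; apply: contraNneq ne => ->.
exists X; split=> //.
- by move=> _ /imfsetP[i _ ->]; rewrite /enorm v1 sqrtr1.
- by rewrite card_imfset //= -cardE.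
split; first by apply/negP => /XA; rewrite !inE; case/or4P => /eqP; lra.
suff /fsubset_leq_card/leq_trans :
    [fset g ^+ 2 | g in angle_set X] `<=` [fset (1 / 5) ^+ 2; (3 / 5) ^+ 2].
  by apply; rewrite cardfs2; case: eqP.
apply/fsubsetP => _ /imfsetP[g /= /XA gA ->]; move: gA; rewrite !inE.
by case/or4P => /eqP ->; rewrite ?sqrrN eqxx ?orbT.
Qed.

End InnerProduct.

(** * Signed even words *)

Section EvenWords.

(* The coordinates are [false], a parity bit and [t], so that complementary
   words are not both represented. *)
Definition even_word n (t : {ffun 'I_n -> bool}) (i : 'I_n.+2) : bool :=
  if unlift ord0 i is Some j then
    if unlift ord0 j is Some l then t l else odd (\sum_l t l)
  else false.

Definition ffun_xor n (t u : {ffun 'I_n -> bool}) : {ffun 'I_n -> bool} :=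
  [ffun i => t i (+) u i].

Lemma odd_sum_xor n (t u : {ffun 'I_n -> bool}) :
  odd (\sum_l ffun_xor t u l) = odd (\sum_l t l) (+) odd (\sum_l u l).
Proof.
rewrite -oddD -big_split /= !(big_morph odd oddD (erefl _)).
by apply: eq_bigr => l _; rewrite ffunE oddD !oddb.
Qed.

Lemma even_word_xor n (t u : {ffun 'I_n -> bool}) i :
  even_word t i (+) even_word u i = even_word (ffun_xor t u) i.
Proof.
rewrite /even_word; case: unliftP => // j _; case: unliftP => [l|] _.
  by rewrite ffunE.
by rewrite odd_sum_xor.
Qed.

Definition even_weight n (t : {ffun 'I_n -> bool}) := (\sum_i even_word t i)%N.

Lemma even_weightE n (t : {ffun 'I_n -> bool}) :
  even_weight t = (odd (\sum_l t l) + \sum_l t l)%N.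
Proof.
rewrite /even_weight !big_ord_recl /even_word unlift_none /= liftK unlift_none.
by rewrite add0n; congr addn; apply: eq_bigr => l _; rewrite !liftK.
Qed.

Lemma even_weight_gt0 n (t u : {ffun 'I_n -> bool}) :
  t != u -> (0 < even_weight (ffun_xor t u))%N.
Proof.
rewrite even_weightE addn_gt0 => tu; apply/orP; right.
rewrite lt0n sum_nat_eq0; apply: contra tu => /forallP tu0.
by apply/eqP/ffunP => i; move: (tu0 i); rewrite ffunE; case: (t i); case: (u i).
Qed.

(** The first coordinate is always [false]. In length 10 this excludes weight 10, that is, antipodal
    sign vectors. *)
Lemma even_weight_le n (t : {ffun 'I_n -> bool}) : (even_weight t <= n.+1)%N.
Proof.
rewrite even_weightE -addn1 addnC leq_add //; last by case: odd.
by rewrite -[leqRHS]card_ord -sum1_card leq_sum // => l _; case: (t l).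
Qed.

Lemma odd_even_weight n (t : {ffun 'I_n -> bool}) : odd (even_weight t) = false.
Proof. by rewrite even_weightE oddD oddb addbb. Qed.

Definition sign_row (R : realType) n (t : {ffun 'I_n -> bool}) : 'rV[R]_n.+2 :=
  \row_i (-1) ^+ even_word t i.

Lemma inner_sign_row (R : realType) n (t u : {ffun 'I_n -> bool}) :
  inner (sign_row R t) (sign_row R u) =
  n.+2%:R - 2 * (even_weight (ffun_xor t u))%:R.
Proof.
have -> : n.+2%:R = \sum_(i < n.+2) 1 :> R by rewrite sumr_const card_ord.
rewrite natr_sum mulr_sumr -sumrB.
apply: eq_bigr => i _; rewrite !mxE -signr_addb even_word_xor.
by case: even_word; rewrite /= ?expr1 ?expr0; lra.
Qed.

Lemma inner_sign_rowxx (R : realType) n (t : {ffun 'I_n -> bool}) :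
  inner (sign_row R t) (sign_row R t) = n.+2%:R.
Proof.
rewrite inner_sign_row even_weightE.
rewrite big1 ?mulr0 ?subr0 // => l _.
by rewrite ffunE addbb.
Qed.

End EvenWords.

(** * Extension by equiangular lines *)

Section Extension.
Context {R : realType} (k : nat) (J : finType) (e : J -> 'rV[R]_k).
Hypothesis e1 : forall j, inner (e j) (e j) = 1.
Hypothesis e13 : forall i j, i != j -> inner (e i) (e j) \in [:: 1 / 3; - (1 / 3)].

Definition extension_index : finType :=
  ({ffun 'I_8 -> bool} + 'I_10 * bool * J)%type.

Definition extension (x : extension_index) : 'rV[R]_(10 + k) :=
  (Num.sqrt 10)^-1 *:
  match x with
  | inl t => row_mx (sign_row R t) 0
  | inr (i, s, j) => row_mx (((-1) ^+ s * 2) *: delta_mx 0 i) (Num.sqrt 6 *: e j)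
  end.

Lemma inner_scaled (u v : 'rV[R]_(10 + k)) :
  inner ((Num.sqrt 10)^-1 *: u) ((Num.sqrt 10)^-1 *: v) = inner u v / 10.
Proof. by rewrite innerZ -invfM -expr2 sqr_sqrtr 1?mulrC //; lra. Qed.

Lemma inner_spikes i s j i' s' j' :
  inner (extension (inr (i, s, j))) (extension (inr (i', s', j'))) =
  ((-1) ^+ (s (+) s') * 4 *+ (i == i') + 6 * inner (e j) (e j')) / 10.
Proof.
rewrite inner_scaled inner_row_mx !innerZ inner_delta mxE eqxx /= eq_sym.
rewrite -expr2 sqr_sqrtr; last by lra.
by rewrite -[(_ * 4) *+ _]mulr_natr signr_addb; ring.
Qed.

(** Only coordinate [i] contributes, by 2 or -2 before the division by 10. *)
Lemma inner_cube_spike t i s j :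
  inner (extension (inl t)) (extension (inr (i, s, j))) \in angles.
Proof.
rewrite inner_scaled inner_row_mx innerC (innerC 0) inner0r addr0.
rewrite -[sign_row R t]scale1r innerZ mulr1 innerC inner_delta mxE.
suff -> : (-1) ^+ s * 2 * (-1) ^+ even_word t i / 10 =
          (-1) ^+ (s (+) even_word t i) / 5 :> R.
  by rewrite !inE; case: (_ (+) _); rewrite ?expr0 ?expr1 ?mulNr ?eqxx ?orbT.
by rewrite signr_addb; field.
Qed.

Lemma inner_extensionxx x : inner (extension x) (extension x) = 1.
Proof.
case: x => [t|[[i s] j]].
  by rewrite inner_scaled inner_row_mx inner0r inner_sign_rowxx; field.
by rewrite inner_spikes eqxx addbb e1 /= expr0 mulr1n; field.
Qed.

(** For two spikes, 10 times the inner product is a sum of 4, -4 or 0 from the first block and 6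
    (same line) or 2, -2 (distinct lines) from the second. For distinct spikes the sum 6 + 4 cannot
    occur, so only 2, -2, 6 and -6 remain. *)
Lemma inner_extension x y :
  x != y -> inner (extension x) (extension y) \in angles.
Proof.
case: x y => [t|[[i s] j]] [u|[[i' s'] j']] ne.
- rewrite inner_scaled inner_row_mx inner0r inner_sign_row addr0.
  have := even_weight_gt0 ne; have := even_weight_le (ffun_xor t u).
  have := odd_even_weight (ffun_xor t u).
  (* An even weight between 1 and 9 is 2, 4, 6 or 8; the four goals are the values 3/5, 1/5, -1/5,
     -3/5 in this order. *)
  move: (even_weight _); do 10?[case=> //] => _ _ _; rewrite !inE; apply/or4P;
    [apply: Or43|apply: Or41|apply: Or42|apply: Or44]; apply/eqP; by field.
- exact: inner_cube_spike.
- by rewrite innerC; exact: inner_cube_spike.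
rewrite inner_spikes !inE; have [jj|/e13] := eqVneq j j'.
  rewrite {}jj e1 in ne *; have [ii|_] := eqVneq i i'; last first.
    by apply/or4P; apply: Or43; apply/eqP; rewrite mulr0n; field.
  have -> : s (+) s' by rewrite ii in ne; case: s s' ne => [] [] //; rewrite eqxx.
  by apply/or4P; apply: Or41; apply/eqP; rewrite /= expr1 mulr1n; field.
rewrite !inE => /orP[]/eqP ->; case: (i == i'); case: (s (+) s');
  rewrite /= ?expr0 ?expr1 ?mulr1n ?mulr0n; apply/or4P.
- by apply: Or42; apply/eqP; field.
- by apply: Or43; apply/eqP; field.
- by apply: Or41; apply/eqP; field.
- by apply: Or41; apply/eqP; field.
- by apply: Or44; apply/eqP; field.
- by apply: Or41; apply/eqP; field.
- by apply: Or42; apply/eqP; field.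
- by apply: Or42; apply/eqP; field.
Qed.

Lemma card_extension_index : #|extension_index| = (256 + 20 * #|J|)%N.
Proof. by rewrite card_sum card_ffun !card_prod !card_ord card_bool. Qed.

Lemma biangular_extension :
  exists X : {fset 'rV[R]_(10 + k)},
    [/\ unit_vectors X, #|` X| = (256 + 20 * #|J|)%N, spans_biangular X &
        {subset angle_set X <= angles}].
Proof.
rewrite -card_extension_index.
exact: biangular_of_family inner_extensionxx inner_extension.
Qed.

End Extension.

(** * Equiangular lines *)

(** Scaling coordinate [l] by the square root of [w_l / 6] turns the products 6, 2, -2 into 1, 1/3,
    -1/3. All irrationalities are thus hidden in the integer weights, and equiangularity is decided
    by computation. *)
Definition wdot k (w : seq nat) (x y : seq int) : int :=
  foldr (fun l s => (nth 0 w l)%:Z * x`_l * y`_l + s) 0 (iota 0 k).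

Definition equiangular_rows k (w : seq nat) (r : seq (seq int)) : bool :=
  all (fun i => all (fun j => wdot k w (nth [::] r i) (nth [::] r j) \in
                       if i == j then [:: 6] else [:: 2; - 2])
                    (iota 0 (size r))) (iota 0 (size r)).

Lemma equiangular_family (R : realType) k w r : equiangular_rows k w r ->
  exists e : 'I_(size r) -> 'rV[R]_k,
    (forall i, inner (e i) (e i) = 1) /\
    (forall i j, i != j -> inner (e i) (e j) \in [:: 1 / 3; - (1 / 3)]).
Proof.
move=> /allP rP.
pose x (i : nat) : seq int := nth [::] r i.
pose e (i : 'I_(size r)) : 'rV[R]_k :=
  \row_l (Num.sqrt ((nth 0 w l)%:R / 6) * ((x i)`_l)%:~R).
have eE i j : inner (e i) (e j) = (wdot k w (x i) (x j))%:~R / 6.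
  pose F l := (nth 0 w l)%:Z * (x i)`_l * (x j)`_l.
  have -> : wdot k w (x i) (x j) = \sum_(l < k) F l.
    (* Once unlocked, the sum over [iota 0 k] is the [foldr] of [wdot]. *)
    by rewrite -(big_mkord xpredT F) /index_iota subn0 unlock.
  rewrite rmorph_sum mulr_suml; apply: eq_bigr => l _; rewrite !mxE mulrACA.
  rewrite -expr2 sqr_sqrtr; last by rewrite divr_ge0 // ler0n.
  by rewrite !rmorphM /= -pmulrn; ring.
have eP (i j : 'I_(size r)) :
    wdot k w (x i) (x j) \in if i == j then [:: 6] else [:: 2; - 2].
  have iotaP (l : 'I_(size r)) : (l : nat) \in iota 0 (size r).
    by rewrite mem_iota /=.
  by have /allP/(_ _ (iotaP j)) := rP _ (iotaP i).
exists e; split=> [i|i j /negPf ij]; have := eP i; rewrite eE.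
  by move=> /(_ i); rewrite eqxx inE => /eqP ->; field.
move=> /(_ j); rewrite ij !inE => /orP[]/eqP ->; apply/orP.
  by left; apply/eqP; field.
by right; apply/eqP; field.
Qed.

(** The sign at [a] is fixed, which leaves one vector per line. With all weights 2, two of the four
    vectors have product 2 or -2, and so do vectors on triples sharing exactly one point. Entries
    beyond the end of a row are read as 0. *)
Definition signed_triple (l : nat * nat * nat) : seq (seq int) :=
  let: (a, b, c) := l in
  [seq set_nth 0 (set_nth 0 (set_nth 0 [::] a 1) b s) c t
     | s <- [:: 1; -1], t <- [:: 1; -1]].

Definition fano : seq (nat * nat * nat) :=
  [:: (0, 1, 2); (0, 3, 4); (1, 3, 5); (2, 4, 5);
      (0, 5, 6); (1, 4, 6); (2, 3, 6)]%N.

(* The last six rows are the vectors of the 6-dimensional configuration, with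
   coordinates 3, 4, 5 of sum 0, in an orthogonal basis of that plane. *)
Definition rows5 : seq (seq int) :=
  signed_triple (0, 1, 2)%N ++
  [:: [:: 1; 0; 0; 2; 0]; [:: 1; 0; 0; -2; 0];
      [:: 0; 1; 0; 1; 1]; [:: 0; 1; 0; -1; -1];
      [:: 0; 0; 1; -1; 1]; [:: 0; 0; 1; 1; -1]].

Lemma equiangular_exists (R : realType) k m :
    (k, m) \in [:: (0, 0); (1, 1); (2, 2); (3, 4);
                   (5, 10); (6, 16); (7, 28)]%N ->
  exists e : 'I_m -> 'rV[R]_k,
    (forall i, inner (e i) (e i) = 1) /\
    (forall i j, i != j -> inner (e i) (e j) \in [:: 1 / 3; - (1 / 3)]).
Proof.
pose fanor n := flatten [seq signed_triple l | l <- take n fano].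
rewrite !inE; do 6?[case/orP]; move=> /eqP[-> ->].
- exact: (@equiangular_family R 0 [::] [::]).
- exact: (@equiangular_family R 1 [:: 6%N] [:: [:: 1]]).
- exact: (@equiangular_family R 2 [:: 4; 2]%N [:: [:: 1; 1]; [:: 1; -1]]).
- exact: (@equiangular_family R 3 (nseq 3 2%N) (fanor 1%N)).
(* The weights 1 and 3 are the squared lengths, for the form with all weights 2, of
   [(b_3 - b_4) / 2] and [(b_3 + b_4 - 2 b_5) / 2]. *)
- exact: (@equiangular_family R 5 [:: 2; 2; 2; 1; 3]%N rows5).
(* The first four triples of [fano] are the lines avoiding the point 6. *)
- exact: (@equiangular_family R 6 (nseq 6 2%N) (fanor 4%N)).
- exact: (@equiangular_family R 7 (nseq 7 2%N) (fanor 7%N)).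
Qed.

Theorem corollary2p14 (R : realType) (d n : nat)
    (hdn : (d, n) \in [:: (10, 256); (11, 276); (12, 296); (13, 336);
                          (15, 456); (16, 576); (17, 816)]%N) :
  exists X : {fset 'rV[R]_d},
    [/\ unit_vectors X,
        #|` X| = n,
        spans_biangular X &
        {subset angle_set X <= [:: 1 / 5; - (1 / 5); 3 / 5; - (3 / 5)]}].
Proof.
have [k [m [-> -> /(equiangular_exists R)[e [e1 e13]]]]] : exists k m,
    [/\ d = (10 + k)%N, n = (256 + 20 * m)%N &
     (k, m) \in [:: (0, 0); (1, 1); (2, 2); (3, 4);
                    (5, 10); (6, 16); (7, 28)]%N].
  move: hdn; rewrite !inE; do 6?[case/orP]; move=> /eqP[-> ->].
  - by exists 0%N, 0%N.
  - by exists 1%N, 1%N.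
  - by exists 2%N, 2%N.
  - by exists 3%N, 4%N.
  - by exists 5%N, 10%N.
  - by exists 6%N, 16%N.
  - by exists 7%N, 28%N.
by have := biangular_extension e1 e13; rewrite card_ord.
Qed.
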